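(* For every $\varepsilon>0$ there is a constant $K(\varepsilon)$ such that the following holds. Let $R,H,Q,N\ge 1$ be real numbers with $R\le H/2$, and let $\delta>0$. Let $\mathcal{N}(R,Q,H,N,\delta)$ denote the number of integer points $(r,q_1,q_2,h_1,h_2,n_1,n_2)\in\mathbb{Z}^7$ satisfying $$0<|r|<R,\quad Q\le|q_i|<2Q,\quad H\le h_i<2H,\quad 1\le n_i\le N\ (i=1,2),\quad q_1q_2>0,$$ together with $$rn_1+h_1q_1=rn_2+h_2q_2,$$ $$\bigl|rn_1^2+2h_1q_1n_1+h_1q_1^2-(rn_2^2+2h_2q_2n_2+h_2q_2^2)\bigr|\le \delta HQ^2.$$ Then $$\mathcal{N}(R,Q,H,N,\delta)\le K(\varepsilon)\,(RNHQ)^{1+\varepsilon}(1+\delta Q).$$ *)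

(* Defs.v *)
From mathcomp Require Import all_boot all_order all_algebra finmap.
From mathcomp Require Import all_classical all_reals all_analysis.
Set Implicit Arguments.
Unset Strict Implicit.
Unset Printing Implicit Defensive.
Import Order.TTheory GRing.Theory Num.Theory.
Local Open Scope classical_set_scope.
Local Open Scope ring_scope.

Definition solutions (F : realType) (R Q H N delta : F) :
    set (int * int * int * int * int * int * int)%type :=
  [set p | let: (r, q1, q2, h1, h2, n1, n2) := p in
    [/\ [/\ 0 < `|r%:~R : F| < R,
            (Q <= `|q1%:~R : F| < 2 * Q) /\ (Q <= `|q2%:~R : F| < 2 * Q),
            (H <= (h1%:~R : F) < 2 * H) /\ (H <= (h2%:~R : F) < 2 * H),
            (1 <= (n1%:~R : F) <= N) /\ (1 <= (n2%:~R : F) <= N)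
          & 0 < q1 * q2],
        r * n1 + h1 * q1 = r * n2 + h2 * q2
      & `|(r * n1 ^+ 2 + 2 * h1 * q1 * n1 + h1 * q1 ^+ 2
           - (r * n2 ^+ 2 + 2 * h2 * q2 * n2 + h2 * q2 ^+ 2))%:~R : F|
          <= delta * H * Q ^+ 2]].

Lemma finite_int_ball (F : realType) (B : F) :
  finite_set [set z : int | `|z%:~R : F| <= B].
Proof.
pose m := (Num.truncn B).+1.
apply: (@sub_finite_set _ _ ((Posz @` `I_m) `|` ((fun n => - Posz n) @` `I_m))).
  move=> z /= zB.
  have zm : (`|z|%N < m)%N.
    have zE : `|z%:~R : F| = (`|z|%N)%:R by rewrite -intr_norm -abszE.
    rewrite -(ltr_nat F) -zE; apply: le_lt_trans zB _.
    exact: truncnS_gt.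
  have [z0|z0] := leP 0 z; [left|right]; exists `|z|%N => //=.
    by rewrite gez0_abs.
  by rewrite ltz0_abs// opprK.
by rewrite finite_setU; split; apply: finite_image; exact: finite_II.
Qed.

(* [fset_set] is [fset0] on infinite sets; finiteness shows that the
   cardinal below is the actual number of solutions. *)
Lemma finite_solutions (F : realType) (R Q H N delta : F) :
  finite_set (solutions R Q H N delta).
Proof.
have fb := @finite_int_ball F.
apply: sub_finite_set (finite_setX (finite_setX (finite_setX (finite_setX
  (finite_setX (finite_setX (fb R) (fb (2 * Q))) (fb (2 * Q)))
  (fb `|2 * H|)) (fb `|2 * H|)) (fb N)) (fb N)).
have hb (h : int) : H <= h%:~R < 2 * H -> `|h%:~R : F| <= `|2 * H|.
  move=> /andP[h1 h2]; have H0 : 0 <= H.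
    have := le_lt_trans h1 h2.
    by rewrite mulr_natl mulr2n -subr_gt0 addrK => /ltW.
  rewrite ger0_norm ?(le_trans H0)// ger0_norm ?mulr_ge0//; exact: ltW.
have nb (n : int) : 1 <= (n%:~R : F) <= N -> `|n%:~R : F| <= N.
  by move=> /andP[n1 n2]; rewrite ger0_norm// (le_trans ler01).
move=> [[[[[[r q1] q2] h1] h2] n1] n2] /=.
case=> -[/andP[_ /ltW rR] [/andP[_ /ltW a] /andP[_ /ltW b]]].
by move=> [/hb c /hb d] [/nb e /nb f] _ _ _.
Qed.

Definition nb_solutions (F : realType) (R Q H N delta : F) : nat :=
  #|` fset_set (solutions R Q H N delta)|.

(* Main.v *)
(* Put m = n2 - n1 and k = 2 m - q1 + q2.  The conditions become
   h1 q1 - h2 q2 = r m and |E| <= delta H Q^2 with E = h2 q2 k - r m (q1 - m),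
   so n1 contributes a factor N.  For fixed (q1, q2, m) they are linear in
   (r, h1, h2); for fixed (r, h1, h2) they are homogeneous in (q1, q2, m).
   Dividing both triples by their gcds i and j replaces (R, H, Q) by
   (R/i, H/i, Q/j), and the sum over i, j costs only logarithms.

   For primitive triples with Q >= H, fix (r, h1, h2): the slopes q2/q1 lie in
   a short interval, since h1 (h1 - r) q1^2 - h2 (h2 - r) q2^2 = r E, and they
   are well spaced, since r divides each determinant q2 q1' - q2' q1.
   For Q <= H and k <> 0, fix (q1, q2, k): the slopes r/h2 lie in a short
   interval, and q1 divides each determinant r h2' - r' h2; the identity
   4 E = k ((2 h1 - r) q1 + (2 h2 - r) q2) - r (q1^2 - q2^2) bounds k.
   For k = 0, fix (r, q1, q2): q1 divides 2 (h2 - h2'). *)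

Require Import Defs.
From mathcomp Require Import all_boot all_order all_algebra.
From mathcomp Require Import all_classical all_reals all_analysis.
From mathcomp Require Import ring lra zify.
Import Order.TTheory GRing.Theory Num.Theory.
Local Open Scope ring_scope.

(** * Counting tools: fibres, spaced points, harmonic sums *)

Section Counting.
Context {F : realType}.

(** Cardinality bounds are phrased through duplicate-free lists, so that no finiteness proof is owed
    for the intermediate predicates and the bound can be any real number. *)
Definition at_most {T : eqType} (P : T -> Prop) (B : F) : Prop :=
  forall s : seq T, uniq s -> (forall x, x \in s -> P x) -> (size s)%:R <= B.

Lemma at_most_trans (T : eqType) (P : T -> Prop) (B C : F) :
  at_most P B -> B <= C -> at_most P C.
Proof. by move=> PB BC s us sP; apply: le_trans (PB s us sP) BC. Qed.

Lemma at_most_empty (T : eqType) (P : T -> Prop) (B : F) :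
  0 <= B -> (forall x, ~ P x) -> at_most P B.
Proof. by move=> B0 nP [|x s] //= _ /(_ x (mem_head _ _)) /nP. Qed.

Lemma at_most_inj (T U : eqType) (f : T -> U) (P : T -> Prop) (P' : U -> Prop)
    (B : F) :
  (forall x, P x -> P' (f x)) ->
  (forall x y, P x -> P y -> f x = f y -> x = y) ->
  at_most P' B -> at_most P B.
Proof.
move=> PP' finj B' s us sP; rewrite -(size_map f); apply: B'.
  by rewrite map_inj_in_uniq// => x y /sP Px /sP Py; exact: finj.
by move=> _ /mapP[x /sP Px ->]; exact: PP'.
Qed.

Lemma at_most_fibers (T U : eqType) (f : T -> U) (r : seq U) (P : T -> Prop)
    (b : U -> F) :
  (forall x, P x -> f x \in r) ->
  (forall u, u \in r -> at_most (fun x => P x /\ f x = u) (b u)) ->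
  at_most P (\sum_(u <- r) b u).
Proof.
move=> fr hb s us sP.
have le_fib : (size s <= \sum_(u <- r) count (fun x => f x == u) s)%N.
  elim: s {us} sP => [|x s IH] sP //=.
  rewrite big_split /= -add1n leq_add ?IH//; last first.
    by move=> y ys; apply: sP; rewrite inE ys orbT.
  rewrite (big_rem (f x)) /=; last by apply/fr/sP/mem_head.
  by rewrite eqxx.
have := le_fib; rewrite -(ler_nat F) => /le_trans; apply.
rewrite natr_sum big_seq_cond [leRHS]big_seq_cond.
apply: ler_sum => u; rewrite andbT => ur.
rewrite -size_filter; apply: (hb u ur); first exact: filter_uniq.
by move=> x; rewrite mem_filter => /andP[/eqP fxu /sP].
Qed.

Lemma at_most_const_fibers (T U : eqType) (f : T -> U) (r : seq U)
    (P : T -> Prop) (a b : F) :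
  (forall x, P x -> f x \in r) -> (size r)%:R <= a -> 0 <= b ->
  (forall u, u \in r -> at_most (fun x => P x /\ f x = u) b) ->
  at_most P (a * b).
Proof.
move=> fr ra b0 hb; apply: at_most_trans.
  exact: (@at_most_fibers T U f r P (fun=> b)).
by rewrite big_const_seq count_predT iter_addr_0 -mulr_natl ler_wpM2r.
Qed.

Lemma at_most_disj (T : eqType) (P P1 P2 : T -> Prop) (a b : F) :
  (forall x, P x -> P1 x \/ P2 x) -> at_most P1 a -> at_most P2 b ->
  at_most P (a + b).
Proof.
move=> P12 P1a P2b s us sP.
rewrite -(count_predC (fun x => `[< P1 x >]) s) natrD lerD//.
  rewrite -size_filter; apply: P1a; first exact: filter_uniq.
  by move=> x; rewrite mem_filter => /andP[/asboolP].
rewrite -size_filter; apply: P2b; first exact: filter_uniq.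
by move=> x; rewrite mem_filter /= => /andP[/asboolPn nP1 /sP/P12[]].
Qed.

Definition nzints (n : nat) : seq int :=
  [seq Posz k.+1 | k <- iota 0 n] ++ [seq - Posz k.+1 | k <- iota 0 n].

Lemma size_nzints (X : F) : 0 <= X -> (size (nzints (Num.truncn X)))%:R <= 2 * X.
Proof.
move=> X0; rewrite size_cat !size_map size_iota addnn -mul2n natrM ler_wpM2l//.
by rewrite Num.Theory.truncn_le.
Qed.

Lemma mem_nzints (n : nat) (z : int) :
  (z \in nzints n) = (z != 0) && (`|z|%N <= n)%N.
Proof.
rewrite mem_cat; apply/orP/andP => [[] /mapP[k]|[z0 zn]].
- by rewrite mem_iota => /andP[_ kn] ->.
- by rewrite mem_iota => /andP[_ kn] ->; rewrite abszN; split => //; lia.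
have [zp|zp] := leP 0 z; [left|right]; apply/mapP; exists (`|z|.-1)%N;
  rewrite ?mem_iota; lia.
Qed.

Lemma absz_intr (z : int) : (`|z|%N)%:R = `|z%:~R| :> F.
Proof. by rewrite -intr_norm -abszE. Qed.

Lemma mem_nzints_trunc (X : F) (z : int) :
  z != 0 -> `|z%:~R : F| <= X -> z \in nzints (Num.truncn X).
Proof.
move=> z0 zX; rewrite mem_nzints z0 -ltnS -(ltr_nat F) absz_intr.
by apply: le_lt_trans zX _; exact: truncnS_gt.
Qed.

(* The map [x |-> floor ((u x - u x0) / g)] is injective. *)
Lemma at_most_spaced (T : eqType) (P : T -> Prop) (u : T -> F) (g l : F) :
  0 < g -> 0 <= l ->
  (forall x y, P x -> P y -> x <> y -> g <= `|u x - u y|) ->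
  (forall x y, P x -> P y -> `|u x - u y| <= l) ->
  at_most P (3 + 2 * (l / g)).
Proof.
move=> g0 l0 hg hl.
have lg0 : 0 <= l / g by rewrite divr_ge0 // (ltW g0).
case=> [|x0 s]; first by move=> _ _ /=; lra.
set s' := x0 :: s => us sP.
have Px0 : P x0 by apply/sP/mem_head.
pose f x := Num.floor ((u x - u x0) / g).
(* The scaled differences lie in [[- l / g, l / g]], so their floors have absolute value at most
   [l / g + 1]. Counting 0 separately gives [1 + 2 * (l / g + 1)]. *)
pose r := 0 :: nzints (Num.truncn (l / g + 1)).
have fE x : (f x)%:~R <= (u x - u x0) / g < (f x)%:~R + 1.
  by rewrite floor_le /= -[1]/(1%:~R) -intrD floorD1_gt.
have uf : uniq (map f s').
  rewrite map_inj_in_uniq// => x y /sP Px /sP Py fxy; apply: contrapT => xy.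
  have := hg x y Px Py xy; apply/negP; rewrite -ltNge.
  have /andP[a1 a2] := fE x; have /andP[b1 b2] := fE y.
  rewrite fxy in a1 a2.
  have -> : u x - u y = g * ((u x - u x0) / g - (u y - u x0) / g).
    by field; rewrite gt_eqF.
  rewrite normrM (gtr0_norm g0) gtr_pMr// ltr_norml; apply/andP; split; lra.
have : (size (map f s') <= size r)%N.
  apply: uniq_leq_size uf _ => _ /mapP[x /sP Px ->]; rewrite inE.
  have [//|fx0] := eqVneq (f x) 0; rewrite mem_nzints_trunc//.
  have /andP[a1 a2] := fE x.
  have : `|(u x - u x0) / g| <= l / g.
    by rewrite normrM [X in _ * X]gtr0_norm ?invr_gt0// ler_pM2r ?invr_gt0// hl.
  rewrite !ler_norml => /andP[b1 b2]; apply/andP; split; lra.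
rewrite size_map -(ler_nat F) => /le_trans; apply.
have := @size_nzints (l / g + 1) _; rewrite /= -natr1 => h.
by have := h (addr_ge0 lg0 ler01); lra.
Qed.

Definition harm (n : nat) : F := \sum_(1 <= k < n.+1) k%:R^-1.

Lemma harm_ge1 n : (0 < n)%N -> 1 <= harm n.
Proof.
by move=> n0; rewrite /harm big_ltn// invr1 lerDl sumr_ge0.
Qed.

Lemma harm_le (m n : nat) : (m <= n)%N -> harm m <= harm n.
Proof.
move=> mn; rewrite /harm (@big_cat_nat _ _ _ m.+1 1 n.+1)//= lerDl.
by rewrite sumr_ge0// => i _; rewrite invr_ge0.
Qed.

Lemma harm_nzints (n : nat) :
  \sum_(k <- nzints n) `|k%:~R : F|^-1 = 2 * harm n.
Proof.
have harmE : \sum_(k <- iota 0 n) k.+1%:R^-1 = harm n.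
  rewrite /harm -[in RHS](add0n 1%N) -addn1 big_addn addn1 subn1/= /index_iota subn0.
  by apply: eq_bigr => k _; rewrite addn1.
rewrite /nzints big_cat /= !big_map mulr_natl mulr2n -harmE; congr (_ + _);
  by apply: eq_bigr => k _; rewrite ?intrN ?normrN ger0_norm.
Qed.

Lemma harm_le_ln n : harm n.+1 <= 1 + ln n.+1%:R.
Proof.
elim: n => [|n IH]; first by rewrite /harm big_nat1 invr1 ln1 addr0.
rewrite /harm big_nat_recr//=; apply: le_trans (lerD IH (lexx _)) _.
rewrite -addrA lerD2l.
have n1 : (0 : F) < n.+1%:R by rewrite ltr0n.
have n2 : (0 : F) < n.+2%:R by rewrite ltr0n.
(* [ln (1 + x) <= x] at [x = - 1 / (n + 2)] gives [1 / (n + 2) <= ln (n + 2) - ln (n + 1)], which is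
   the induction step. *)
have := @le_ln1Dx F (- n.+2%:R^-1).
have -> : 1 - n.+2%:R^-1 = n.+1%:R / n.+2%:R :> F.
  by apply: (mulIf (lt0r_neq0 n2)); rewrite mulrBl mulVf ?mulfVK ?gt_eqF// mul1r -natr1 addrK.
rewrite ln_div ?posrE//.
have -> : -1 < - n.+2%:R^-1 :> F by rewrite ltrN2 invf_lt1// ltr1n.
by move=> /(_ isT); rewrite lerBlDr (addrC (- _)) -lerBrDr.
Qed.

(** Apply [ln y < y] to [y = x ^ e]. *)
Lemma ln_le_powR (e x : F) : 0 < e -> 0 < x -> ln x <= x `^ e / e.
Proof.
move=> e0 x0; rewrite ler_pdivlMr// mulrC -ln_powR.
by apply/ltW/ln_sublinear; rewrite powR_gt0.
Qed.

End Counting.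

(** * Primitive integer triples *)

(** Coprimality is stated as a Bezout relation: multiplying it by an integer d turns divisibility of
    d a, d b, d c into divisibility of d itself. *)
Definition primitive (a b c : int) : Prop :=
  exists u v w : int, u * a + v * b + w * c = 1.

Lemma primitive_rot (a b c : int) : primitive a b c -> primitive c a b.
Proof. by move=> [u [v [w e]]]; exists w, u, v; rewrite -e; ring. Qed.

(** Here a divides d a, d b and d c, hence d by Bezout, and d is nonzero. This gives every lower
    bound on determinants below. *)
Lemma primitive_norm_le (F : realType) (a b c d x y : int) :
  primitive a b c -> d != 0 -> d * b = a * x -> d * c = a * y ->
  `|a%:~R : F| <= `|d%:~R|.
Proof.
move=> [u [v [w e]]] d0 dbx dcy.
have dE : d = a * (u * d + v * x + w * y).
  by rewrite -[LHS]mulr1 -e !mulrDr !(mulrCA a) -dbx -dcy; ring.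
move: d0; rewrite dE mulf_eq0 negb_or => /andP[_ z0].
rewrite intrM normrM ler_peMr// -intr_norm -[1]/(1%:~R) ler_int.
by move: z0; lia.
Qed.

(** The vanishing minors make the second triple [l] times the first, with [l] an integer because the
    first is primitive. Primitivity of the second makes [l] a unit, and the sign condition selects
    1. *)
Lemma primitive_proportional (a b c a' b' c' : int) :
  primitive a b c -> primitive a' b' c' ->
  a * b' = a' * b -> a * c' = a' * c -> b * c' = b' * c -> 0 < a * a' ->
  [/\ a = a', b = b' & c = c'].
Proof.
move=> [u [v [w e]]] [u' [v' [w' e']]] ab ac bc aa.
pose l := u * a' + v * b' + w * c'.
pose l' := u' * a + v' * b + w' * c.
have la : a' = l * a.
  by rewrite -[LHS]mulr1 -e /l !(mulrDr, mulrDl) -!mulrA ![a' * (_ * _)]mulrCA;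
     rewrite -ab -ac !(mulrC a).
have lb : b' = l * b.
  by rewrite -[LHS]mulr1 -e /l !(mulrDr, mulrDl) -!mulrA ![b' * (_ * _)]mulrCA;
     rewrite -ab -bc !(mulrC b) (mulrC b').
have lc : c' = l * c.
  rewrite -[LHS]mulr1 -e /l !(mulrDr, mulrDl) -!mulrA ![c' * (_ * _)]mulrCA.
  by rewrite -ac -bc !(mulrC c').
have ll : l * l' = 1 by rewrite -e' la lb lc /l'; ring.
have l0 : 0 < l by move: aa; rewrite la; nia.
have l1 : l = 1.
  have {la lb lc} : forall x y : int, 0 < x -> x * y = 1 -> x = 1.
    move=> x y x0 xy; have y0 : 0 < y by nia.
    by nia.
  by apply; [exact: l0|exact: ll].
by rewrite la lb lc l1 !mul1r.
Qed.

(** * Primitive solutions with H <= Q *)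

Section Primitive.
Context {F : realType}.

(* [m] stands for [n2 - n1]: both conditions depend on the [n_i] only through
   it. *)
Definition shifted_solution (R Q H delta : F)
    (x : int * int * int * int * int * int) : Prop :=
  let: (r, q1, q2, h1, h2, m) := x in
  [/\ [/\ 0 < `|r%:~R : F| < R,
          (Q <= `|q1%:~R : F| < 2 * Q) /\ (Q <= `|q2%:~R : F| < 2 * Q),
          (H <= (h1%:~R : F) < 2 * H) /\ (H <= (h2%:~R : F) < 2 * H)
        & 0 < q1 * q2],
      h1 * q1 - h2 * q2 = r * m
    & `|(h2 * q2 * (2 * m - q1 + q2) - r * m * (q1 - m))%:~R : F|
        <= delta * H * Q ^+ 2].

Definition primitive_solution (R Q H delta : F)
    (x : int * int * int * int * int * int) : Prop :=
  let: (r, q1, q2, h1, h2, m) := x in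
  [/\ shifted_solution R Q H delta x, primitive r h1 h2 & primitive q1 q2 m].

Lemma mem_pairs (S T : eqType) (A : seq S) (B : seq T) a b :
  a \in A -> b \in B -> (a, b) \in [seq (x, y) | x <- A, y <- B].
Proof. by move=> aA bB; apply: allpairs_f. Qed.

Lemma intr_norm_gt0 (X : F) (z : int) : 0 < X -> X <= `|z%:~R : F| -> z != 0.
Proof. by move=> X0 zX; have := lt_le_trans X0 zX; rewrite normr_gt0 intr_eq0. Qed.

Lemma same_sign_intr (p q : int) : 0 < p * q ->
  (0 < (p%:~R : F) /\ 0 < (q%:~R : F)) \/ ((p%:~R : F) < 0 /\ (q%:~R : F) < 0).
Proof.
rewrite !ltr0z !ltrz0; case: (ltgtP p 0) => [p0|p0|->].
- by rewrite nmulr_rgt0//; right.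
- by rewrite pmulr_rgt0//; left.
- by rewrite mul0r ltxx.
Qed.

Lemma same_sign_mul (p q : int) : p != 0 -> q != 0 -> (0 < p) = (0 < q) ->
  0 < p * q.
Proof.
move=> p0 q0; case: (ltgtP 0 p) p0 => // p0 _; case: (ltgtP 0 q) q0 => // q0 _ _.
  exact: mulr_gt0.
by rewrite nmulr_rgt0.
Qed.

(** Turns a lower bound on the determinant of two integer vectors into a gap between their
    slopes. *)
Lemma slope_spacing (a b c d X Y : F) :
  0 < Y -> b != 0 -> d != 0 -> `|b| <= Y -> `|d| <= Y -> X <= `|a * d - c * b| ->
  X / Y ^+ 2 <= `|a / b - c / d|.
Proof.
move=> Y0 b0 d0 bY dY XD.
have -> : a / b - c / d = (a * d - c * b) / (b * d) by field; rewrite ?b0 ?d0.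
have Y2 : 0 < Y ^+ 2 by rewrite exprn_gt0.
have bd : 0 < `|b * d| by rewrite normr_gt0 mulf_neq0.
rewrite normrM normfV ler_pdivlMr// mulrAC ler_pdivrMr//.
apply: le_trans (ler_wpM2r (normr_ge0 _) XD) _.
by rewrite ler_wpM2l// normrM expr2 ler_pM.
Qed.

(** After multiplication by r, m occurs only through [r * m] and can be eliminated, leaving a
    diagonal quadratic form in [q1] and [q2]. *)
Lemma energy_identity (r q1 q2 h1 h2 m : int) : h1 * q1 - h2 * q2 = r * m ->
  r * (h2 * q2 * (2 * m - q1 + q2) - r * m * (q1 - m))
  = h1 * (h1 - r) * q1 ^+ 2 - h2 * (h2 - r) * q2 ^+ 2.
Proof.
move=> e; have -> : r * (h2 * q2 * (2 * m - q1 + q2) - r * m * (q1 - m)) =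
  h2 * q2 * (2 * (r * m) - r * q1 + r * q2) - r * m * (r * q1 - r * m) by ring.
by rewrite -e; ring.
Qed.

(** Divide the identity by [q1 ^+ 2 >= Q ^+ 2]: the slope nearly solves a quadratic equation with
    coefficients fixed by (r, h1, h2). The lower bound 1/2 makes the sum of two slopes at least
    1. *)
Lemma slope_bound (R Q H delta : F) (r q1 q2 h1 h2 m : int) :
  0 < Q -> shifted_solution R Q H delta (r, q1, q2, h1, h2, m) ->
  2^-1 <= (q2%:~R / q1%:~R : F) /\
  `|(h1 * (h1 - r))%:~R - (h2 * (h2 - r))%:~R * (q2%:~R / q1%:~R) ^+ 2 : F|
    <= `|r%:~R| * (delta * H).
Proof.
move=> Q0 [[_ [/andP[q1l q1u] /andP[q2l q2u]] _ pos] E T].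
have q10 := @intr_norm_gt0 _ _ Q0 q1l.
have q1n : (q1%:~R : F) != 0 by rewrite intr_eq0.
have q1p : 0 < `|q1%:~R : F| by rewrite normr_gt0.
split.
  have -> : q2%:~R / q1%:~R = `|q2%:~R| / `|q1%:~R| :> F.
    have [[a b]|[a b]] := same_sign_intr _ _ pos; first by rewrite !gtr0_norm.
    by rewrite !ltr0_norm// invrN mulrNN.
  by rewrite ler_pdivlMr//; lra.
have q1sq : 0 < (q1%:~R : F) ^+ 2 by rewrite exprn_even_gt0.
rewrite -(ler_pM2r q1sq) -[X in _ * X <= _](gtr0_norm q1sq) -normrM.
have -> : ((h1 * (h1 - r))%:~R - (h2 * (h2 - r))%:~R * (q2%:~R / q1%:~R) ^+ 2)
    * q1%:~R ^+ 2 = r%:~R * (h2 * q2 * (2 * m - q1 + q2) - r * m * (q1 - m))%:~R :> F.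
  rewrite -intrM (energy_identity _ _ _ _ _ _ E).
  by field.
rewrite normrM -[leRHS]mulrA ler_wpM2l//; apply: (le_trans T).
have dH : 0 <= delta * H.
  by have := le_trans (normr_ge0 _) T; rewrite pmulr_lge0 ?exprn_gt0.
by rewrite ler_wpM2l// -[leRHS]real_normK ?num_real// lerXn2r ?nnegrE// ltW.
Qed.

Lemma card_primitive_largeQ (R Q H delta : F) :
  0 < R -> 0 < Q -> 0 < H -> 0 < delta -> R <= H / 2 -> H <= Q ->
  at_most (primitive_solution R Q H delta)
    (2048 * (R * H * Q * (1 + delta * Q))).
Proof.
move=> R0 Q0 H0 d0 RH HQ.
pose ints (X : F) := nzints (Num.truncn X).
(* The sign of [q1] is part of the fibre because equal slopes determine a primitive triple only up
   to sign. *)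
pose f (x : int * int * int * int * int * int) :=
  let: (r, q1, q2, h1, h2, m) := x in (r, h1, h2, 0 < q1).
pose rs := [seq (x, y) | x <- [seq (x, y) | x <- [seq (x, y) | x <- ints R,
  y <- ints (2 * H)], y <- ints (2 * H)], y <- [:: true; false]].
have H2 : 0 <= 2 * H by lra.
apply: (@at_most_trans _ _ _ ((2 * R) * (2 * (2 * H)) * (2 * (2 * H)) * 2
  * (3 + 2 * (4 * Q ^+ 2 * 4 * delta / H)))).
  apply: (@at_most_const_fibers _ _ _ f rs).
  - move=> [[[[[r q1] q2] h1] h2] m] [[[/andP[r0 rR] _ [/andP[h10 h11] /andP[h20 h21]] _] _ _] _ _].
    rewrite /f !mem_pairs ?mem_nzints_trunc//; try (by case: (0 < q1)).
    + by rewrite -(intr_eq0 F) -normr_gt0.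
    + exact: ltW.
    + by rewrite -(intr_eq0 F) gt_eqF// (lt_le_trans H0).
    + by rewrite ger0_norm ltW// (lt_le_trans H0).
    + by rewrite -(intr_eq0 F) gt_eqF// (lt_le_trans H0).
    + by rewrite ger0_norm ltW// (lt_le_trans H0).
  - rewrite !size_allpairs !natrM /= ler_wpM2r// !ler_pM ?mulr_ge0 ?ler0n//.
    + exact: size_nzints (ltW R0).
    + exact: size_nzints.
    + exact: size_nzints.
  - by rewrite addr_ge0// !(mulr_ge0, divr_ge0, exprn_ge0, invr_ge0)// ltW.
  move=> [[[r h1] h2] e] _.
  have [r0|r0] := eqVneq r 0.
    apply: at_most_empty.
      by rewrite addr_ge0// !(mulr_ge0, divr_ge0, exprn_ge0, invr_ge0)// ltW.
    move=> [[[[[r' q1] q2] h1'] h2'] m] [[[[/andP[rr _] _ _ _] _ _] _ _]] [re _ _ _].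
    by move: rr; rewrite re r0 normr0 ltxx.
  have rp : 0 < `|r%:~R : F| by rewrite normr_gt0 intr_eq0.
  pose u (x : int * int * int * int * int * int) : F :=
    let: (r, q1, q2, h1, h2, m) := x in q2%:~R / q1%:~R.
  (* Length of the slope interval divided by the minimal gap; the factor |r| cancels. *)
  have -> : 4 * Q ^+ 2 * 4 * delta / H
      = (4 * `|r%:~R| * delta / H) / (`|r%:~R : F| / (2 * Q) ^+ 2).
    by field; rewrite (gt_eqF Q0) (gt_eqF rp) (gt_eqF H0).
  apply: (@at_most_spaced _ _ _ u).
  - by rewrite divr_gt0// exprn_gt0// mulr_gt0.
  - by rewrite divr_ge0 ?mulr_ge0 ?(ltW d0) ?(ltW H0).
  - move=> [[[[[r1 q1] q2] h3] h4] m] [[[[[r2 q1'] q2'] h5] h6] m'].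
    move=> [[[[_ [/andP[q1l q1u] _] _ _] E _] prh prq] [? ? ? eq1]]; subst r1 h3 h4.
    move=> [[[[_ [/andP[q1l' q1u'] _] _ _] E' _] _ prq'] [? ? ? eq1']]; subst r2 h5 h6.
    move=> neq.
    have q10 := @intr_norm_gt0 _ _ Q0 q1l; have q10' := @intr_norm_gt0 _ _ Q0 q1l'.
    apply: slope_spacing; rewrite ?intr_eq0//; [by rewrite mulr_gt0|exact: ltW|exact: ltW|].
    rewrite -!intrM -intrB.
    (* Eliminating [h2], respectively [h1], between the two linear equations shows that r divides
       the determinant times each [h]; primitivity of (r, h1, h2) then gives r divides the
       determinant. *)
    have D1 : (q2 * q1' - q2' * q1) * h1 = r * (m' * q2 - m * q2').
      rewrite !(mulrBl, mulrBr) (mulrA r) (mulrA r) -E -E'; ring.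
    have D2 : (q2 * q1' - q2' * q1) * h2 = r * (q1 * m' - q1' * m).
      rewrite !(mulrBl, mulrBr) (mulrCA r) (mulrCA r q1') -E -E'; ring.
    apply: (primitive_norm_le _ _ _ _ _ _ _ prh _ D1 D2).
    apply/negP => /eqP D0; apply: neq.
    move: D1 D2; rewrite D0 !mul0r => /esym/eqP; rewrite mulf_eq0 (negPf r0)/= subr_eq0 => /eqP D1.
    move=> /esym/eqP; rewrite mulf_eq0 (negPf r0)/= subr_eq0 => /eqP D2.
    have qq : 0 < q1 * q1' by apply: same_sign_mul => //; rewrite eq1 eq1'.
    move/eqP: D0; rewrite subr_eq0 => /eqP D0.
    have [||||-> -> ->//] := primitive_proportional _ _ _ _ _ _ prq prq' => //.
    + by rewrite mulrC -D0 mulrC.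
    + by rewrite mulrC D1 mulrC.
  - move=> [[[[[r1 q1] q2] h3] h4] m] [[[[[r2 q1'] q2'] h5] h6] m'].
    move=> [[sol _ _] [? ? ? _]]; subst r1 h3 h4.
    move=> [[sol' _ _] [? ? ? _]]; subst r2 h5 h6.
    have [al aB] := slope_bound _ _ _ _ _ _ _ _ _ _ Q0 sol.
    have [bl bB] := slope_bound _ _ _ _ _ _ _ _ _ _ Q0 sol'.
    rewrite /u; set a := (_ / _) in al aB *; set b := (_ / _) in bl bB *.
    have [[/andP[_ rR] _ [_ /andP[h2l _]] _] _ _] := sol.
    (* The hypothesis [R <= H / 2] keeps [h2 - r] at least H / 2. *)
    have c2 : H ^+ 2 / 2 <= (h2 * (h2 - r))%:~R.
      rewrite intrM intrB expr2 -mulrA ler_pM//; [exact: ltW|lra|].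
      by move: rR; rewrite ltr_norml => /andP[]; lra.
    move: aB bB; set c := (_ * _)%:~R; set c' := (_ * _)%:~R => aB bB.
    (* Both [c' * a ^+ 2] and [c' * b ^+ 2] are close to the same [c], and [a + b >= 1] passes from
       squares to slopes. *)
    have ab : c' * `|a - b| <= 2 * (`|r%:~R| * (delta * H)).
      have c'0 : 0 <= c' by apply: le_trans c2; rewrite divr_ge0// exprn_ge0// ltW.
      have : c' * `|a ^+ 2 - b ^+ 2| <= 2 * (`|r%:~R| * (delta * H)).
        rewrite -[X in X * _](ger0_norm c'0) -normrM.
        move: aB bB; rewrite !ler_norml => /andP[? ?] /andP[? ?].
        by apply/andP; split; lra.
      apply: le_trans; rewrite ler_wpM2l// subr_sqr normrM ler_peMr//.
      by rewrite ger0_norm; lra.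
    have H2p : 0 < H ^+ 2 / 2 by rewrite divr_gt0// exprn_gt0.
    rewrite -(ler_pM2l H2p); apply: le_trans (ler_wpM2r (normr_ge0 _) c2) _.
    by apply: le_trans ab _; rewrite le_eqVlt; apply/orP; left; apply/eqP; field; rewrite gt_eqF.
have dQ : 0 <= R * H * (delta * Q) * Q by rewrite !mulr_ge0// ltW.
(* [H <= Q] absorbs the fibres that contribute only the constant 3 of the spacing count. *)
have RHH : R * H * H <= R * H * Q by rewrite ler_wpM2l// mulr_ge0// ltW.
have -> : 2 * R * (2 * (2 * H)) * (2 * (2 * H)) * 2 *
  (3 + 2 * (4 * Q ^+ 2 * 4 * delta / H)) =
  192 * (R * H * H) + 2048 * (R * H * (delta * Q) * Q).
  by field; rewrite gt_eqF.
have RHQ : 0 < R * H * Q by rewrite !mulr_gt0.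
by clear -dQ RHH RHQ; lra.
Qed.
End Primitive.

(** * Primitive solutions with Q <= H, split according to k = 2 m - q1 + q2 *)

Section PrimitiveSmall.
Context {F : realType}.

Lemma normr_bounds_mul (a b X Y : F) : `|a| <= X -> `|b| <= Y -> `|a * b| <= X * Y.
Proof. by move=> aX bY; rewrite normrM ler_pM. Qed.

Lemma shift_le (R Q H delta : F) (r q1 q2 h1 h2 m : int) :
  0 < Q -> 0 < H -> R <= H / 2 ->
  shifted_solution R Q H delta (r, q1, q2, h1, h2, m) ->
  `|(2 * m - q1 + q2)%:~R : F| <= R * Q / H + 2 * (delta * Q).
Proof.
move=> Q0 H0 RH [[/andP[_ rR] [/andP[q1l q1u] /andP[q2l q2u]]
  [/andP[h1l _] /andP[h2l _]] pos] E T].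
set k := 2 * m - q1 + q2 in T *.
have e4 : k * ((2 * h1 - r) * q1 + (2 * h2 - r) * q2)
    = 4 * (h2 * q2 * k - r * m * (q1 - m)) + r * (q1 * q1 - q2 * q2).
  have -> : (2 * h1 - r) * q1 + (2 * h2 - r) * q2
      = 2 * (h1 * q1 - h2 * q2) + 4 * h2 * q2 - r * q1 - r * q2 by ring.
  by rewrite E /k; ring.
move: rR; rewrite ltr_norml => /andP[rl ru].
(* Both [2 * h_i - r] are at least 3 H / 2 and the [q_i] share a sign, so the two terms do not
   cancel. *)
have x12 : 3 * H * Q <= `|((2 * h1 - r) * q1 + (2 * h2 - r) * q2)%:~R : F|.
  have a1 : 3 * H / 2 <= (2 * h1 - r)%:~R :> F by lra.
  have a2 : 3 * H / 2 <= (2 * h2 - r)%:~R :> F by lra.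
  have -> : `|((2 * h1 - r) * q1 + (2 * h2 - r) * q2)%:~R : F| =
     (2 * h1 - r)%:~R * `|q1%:~R| + (2 * h2 - r)%:~R * `|q2%:~R|.
    rewrite intrD (intrM _ _ q1) (intrM _ _ q2).
    have p1 : 0 < (2 * h1 - r)%:~R :> F by lra.
    have p2 : 0 < (2 * h2 - r)%:~R :> F by lra.
    have [[a b]|[a b]] := @same_sign_intr F _ _ pos.
      by rewrite !gtr0_norm// addr_gt0// mulr_gt0.
    by rewrite !ltr0_norm// ?mulrN ?opprD// -[ltRHS]addr0 ltrD// pmulr_rlt0.
  have HH : 0 <= 3 * H / 2 by lra.
  have := ler_pM HH (ltW Q0) a1 q1l; have := ler_pM HH (ltW Q0) a2 q2l; lra.
have qq : `|(q1 * q1 - q2 * q2)%:~R : F| <= 3 * Q ^+ 2.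
  rewrite intrB !intrM -!expr2 -(real_normK (num_real q1%:~R)) -(real_normK (num_real q2%:~R)).
  rewrite ler_norml; apply/andP; split; nra.
have : `|k%:~R| * (3 * H * Q) <= 4 * (delta * H * Q ^+ 2) + R * (3 * Q ^+ 2).
  apply: le_trans (ler_wpM2l (normr_ge0 _) x12) _.
  rewrite -normrM -intrM e4 intrD (intrM _ 4) (intrM _ r).
  apply: le_trans (ler_normD _ _) _; apply: lerD; apply: normr_bounds_mul => //.
    by rewrite ger0_norm.
  by rewrite ler_norml !ltW.
have HQ : 0 < 3 * H * Q by rewrite !mulr_gt0.
rewrite -ler_pdivlMr// => /le_trans; apply.
have -> : (4 * (delta * H * Q ^+ 2) + R * (3 * Q ^+ 2)) / (3 * H * Q)
  = 4 / 3 * (delta * Q) + R * Q / H by field; rewrite (gt_eqF Q0) (gt_eqF H0).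
(* The sign of [delta] is read off [T], whose left side is an absolute value. *)
suff : 0 <= delta * Q by lra.
have := le_trans (normr_ge0 _) T; rewrite expr2 mulrA mulrAC pmulr_lge0//.
by rewrite mulrAC pmulr_lge0// mulrC.
Qed.

(** A bound on k free of [delta], from |m| <= |r m| = |h1 q1 - h2 q2|. It keeps the harmonic sum
    over k logarithmic in H Q, however large [delta] is. *)
Lemma shift_le_crude (R Q H delta : F) (r q1 q2 h1 h2 m : int) :
  0 < Q -> 0 < H ->
  shifted_solution R Q H delta (r, q1, q2, h1, h2, m) ->
  `|(2 * m - q1 + q2)%:~R : F| <= 24 * H * Q.
Proof.
move=> Q0 H0 [[/andP[r0 rR] [/andP[q1l q1u] /andP[q2l q2u]]
  [/andP[h1l h1u] /andP[h2l h2u]] pos] E _].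
have rn1 : 1 <= `|r%:~R : F|.
  by move: r0; rewrite -intr_norm ltr0z -[1]/(1%:~R) ler_int.
have m8 : `|m%:~R : F| <= 8 * H * Q.
  apply: (@le_trans _ _ `|(r * m)%:~R|); first by rewrite intrM normrM ler_peMl.
  rewrite -E intrB; apply: le_trans (ler_normB _ _) _; rewrite !intrM.
  have -> : 8 * H * Q = 2 * H * (2 * Q) + 2 * H * (2 * Q) by ring.
  by apply: lerD; apply: normr_bounds_mul; rewrite ?ltW// ger0_norm ?ltW// (lt_le_trans H0).
(* After rescaling H may drop below 1, but the integer [h1] in (0, 2 H) forces H > 1/2. Hence 4 Q <=
   8 H Q, and 16 + 8 = 24. *)
have H12 : 2^-1 <= H.
  have : 1 <= h1%:~R :> F.
    have h10 : 0 < h1 by rewrite -(ltr0z F) (lt_le_trans H0).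
    by rewrite -[1]/(1%:~R) ler_int.
  by lra.
have HQ : 2^-1 * Q <= H * Q by rewrite ler_pM2r.
move: m8 q1u q2u; rewrite !(ler_norml, ltr_norml).
by move=> /andP[? ?] /andP[? ?] /andP[? ?]; apply/andP; split; lra.
Qed.

Lemma card_primitive_shift0 (R Q H delta : F) :
  0 < R -> 0 < Q -> 0 < H -> Q <= H ->
  at_most (fun x => primitive_solution R Q H delta x /\
      let: (r, q1, q2, h1, h2, m) := x in 2 * m - q1 + q2 = 0)
    (224 * (R * H * Q)).
Proof.
move=> R0 Q0 H0 QH.
pose f (x : int * int * int * int * int * int) :=
  let: (r, q1, q2, h1, h2, m) := x in (r, q1, q2).
pose ints (X : F) := nzints (Num.truncn X).
pose rs := [seq (x, y) | x <- [seq (x, y) | x <- ints R,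
  y <- ints (2 * Q)], y <- ints (2 * Q)].
have Q2 : 0 <= 2 * Q by lra.
have HQ0 : 0 <= H / (Q / 2) by rewrite !divr_ge0// ltW.
apply: (@at_most_trans _ _ _ ((2 * R) * (2 * (2 * Q)) * (2 * (2 * Q))
  * (3 + 2 * (H / (Q / 2))))).
  apply: (@at_most_const_fibers _ _ _ f rs).
  - move=> [[[[[r q1] q2] h1] h2] m] [[[[/andP[r0 rR]
      [/andP[q1l q1u] /andP[q2l q2u]] _ _] _ _] _ _] _].
    rewrite /f !mem_pairs ?mem_nzints_trunc//; try exact: ltW.
    + by rewrite -(intr_eq0 F) -normr_gt0.
    + exact: intr_norm_gt0 q1l.
    + exact: intr_norm_gt0 q2l.
  - rewrite !size_allpairs !natrM !ler_pM ?mulr_ge0 ?ler0n//.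
    + exact: size_nzints (ltW R0).
    + exact: size_nzints.
    + exact: size_nzints.
  - by lra.
  move=> [[r q1] q2] _.
  pose u (x : int * int * int * int * int * int) : F :=
    let: (r, q1, q2, h1, h2, m) := x in h2%:~R.
  apply: (@at_most_spaced _ _ _ u).
  - by lra.
  - exact: ltW.
  - move=> [[[[[r1 q3] q4] h1] h2] m] [[[[[r2 q3'] q4'] h1'] h2'] m'].
    move=> [[[[[_ [/andP[q1l q1u] _] _ _] E _] _ prq] k0] [? ? ?]]; subst r1 q3 q4.
    move=> [[[[_ E' _] _ _] k0'] [? ? ?]]; subst r2 q3' q4'.
    move=> neq.
    have mm : m' = m by lia.
    subst m'.
    have q10 := @intr_norm_gt0 _ _ _ Q0 q1l.
    have Eh : (h2 - h2') * q2 = q1 * (h1 - h1').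
      by move: E'; rewrite -E; clear; lia.
    suff : `|q1%:~R : F| <= `|(2 * (h2 - h2'))%:~R|.
      rewrite intrM normrM intrB [`|2%:~R|]ger0_norm// /u => h.
      by have := le_trans q1l h; lra.
    (* Since k = 0 determines 2 m = q1 - q2 rather than m, the multiple of [q1] obtained is
       [2 * (h2 - h2')]; hence the gap Q / 2. *)
    apply: (primitive_norm_le _ _ _ _ _ (2 * (h1 - h1')) (h2 - h2' - (h1 - h1')) prq).
    + apply/negP => /eqP h22; apply: neq.
      have hh : h2 = h2' by lia.
      subst h2'; move: Eh; rewrite subrr mul0r => /esym/eqP.
      by rewrite mulf_eq0 (negPf q10) subr_eq0 => /eqP ->.
    + by rewrite -mulrA Eh; ring.
    + have -> : 2 * (h2 - h2') * m = (h2 - h2') * (2 * m) by ring.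
      have -> : 2 * m = q1 - q2 by lia.
      by rewrite mulrBr Eh; ring.
  - move=> [[[[[r1 q3] q4] h1] h2] m] [[[[[r2 q3'] q4'] h1'] h2'] m'].
    move=> [[[[[_ _ [_ /andP[? ?]] _] _ _] _ _] _] _].
    move=> [[[[[_ _ [_ /andP[? ?]] _] _ _] _ _] _] _].
    by rewrite /u ler_norml; apply/andP; split; lra.
have -> : 2 * R * (2 * (2 * Q)) * (2 * (2 * Q)) * (3 + 2 * (H / (Q / 2)))
  = 96 * (R * Q * Q) + 128 * (R * H * Q) by field; rewrite (gt_eqF Q0).
have : R * Q * Q <= R * H * Q by rewrite ler_wpM2r ?ler_wpM2l// ltW.
by clear; lra.
Qed.

Lemma card_primitive_shiftN0 (R Q H delta : F) (n : nat) :
  1 <= R -> 0 < Q -> 0 < H -> 0 < delta -> R <= H / 2 -> Q <= H ->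
  24 * H * Q <= n%:R ->
  at_most (fun x => primitive_solution R Q H delta x /\
      let: (r, q1, q2, h1, h2, m) := x in 2 * m - q1 + q2 != 0)
    (96 * (R * H * Q) + 192 * (R * H * Q * (delta * Q))
     + 512 * (R * H * Q * (delta * Q) * harm n)).
Proof.
move=> R1 Q0 H0 d0 RH QH Hn.
have R0 : 0 < R by lra.
pose f (x : int * int * int * int * int * int) :=
  let: (r, q1, q2, h1, h2, m) := x in (q1, q2).
pose ints (X : F) := nzints (Num.truncn X).
pose rs := [seq (x, y) | x <- ints (2 * Q), y <- ints (2 * Q)].
pose X := R * Q / H + 2 * (delta * Q).
have X0 : 0 <= X.
  by rewrite addr_ge0 ?mulr_ge0 ?invr_ge0 ?(ltW R0) ?(ltW Q0) ?(ltW d0) ?(ltW H0).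
(* The bound [X] controls how many k occur, and the crude bound controls the length of the sum of 1
   / |k|. *)
pose p := Num.truncn (Num.min X (24 * H * Q)).
have HQ0 : 0 <= 24 * H * Q by rewrite !mulr_ge0 ?(ltW H0) ?(ltW Q0).
have min0 : 0 <= Num.min X (24 * H * Q) by rewrite le_min X0.
have pn : (p <= n)%N.
  rewrite -(ler_nat F); apply: le_trans Hn.
  have : p%:R <= Num.min X (24 * H * Q) by rewrite truncn_le.
  by rewrite le_min => /andP[].
have dRH : 0 <= 16 * delta * R * H by rewrite !mulr_ge0 ?(ltW H0) ?(ltW R0) ?(ltW d0).
have harm0 : 0 <= harm n :> F by rewrite sumr_ge0.
have Q2 : 0 <= 2 * Q by lra.
apply: (@at_most_trans _ _ _ ((2 * (2 * Q)) * (2 * (2 * Q))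
  * (6 * X + 16 * delta * R * H * (2 * harm n)))).
  apply: (@at_most_const_fibers _ _ _ f rs).
  - move=> [[[[[r q1] q2] h1] h2] m] [[[[_
      [/andP[q1l q1u] /andP[q2l q2u]] _ _] _ _] _ _] _].
    rewrite /f mem_pairs ?mem_nzints_trunc//; try exact: ltW.
    + exact: intr_norm_gt0 q1l.
    + exact: intr_norm_gt0 q2l.
  - by rewrite size_allpairs natrM ler_pM ?ler0n ?size_nzints.
  - by rewrite addr_ge0// mulr_ge0// mulr_ge0.
  move=> [q1 q2] _.
  (* Once [q1] and [q2] are fixed, k determines m, and only (r, h1, h2) varies. *)
  pose kf (x : int * int * int * int * int * int) :=
    let: (r, q1, q2, h1, h2, m) := x in 2 * m - q1 + q2.
  apply: (@at_most_trans _ _ _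
      (\sum_(k <- nzints p) (3 + 16 * delta * R * H * `|k%:~R|^-1))); last first.
    rewrite big_split /= -mulr_sumr harm_nzints lerD//.
      rewrite big_const_seq count_predT iter_addr_0 -[leLHS]mulr_natr.
      have : (size (nzints p))%:R <= 2 * X.
        apply: le_trans (size_nzints _ min0) _.
        by rewrite ler_wpM2l// ge_min lexx.
      by lra.
    by rewrite ler_wpM2l// ler_wpM2l// harm_le.
  apply: (@at_most_fibers _ _ _ kf).
    move=> [[[[[r1 q3] q4] h1] h2] m] [[[sol _ _] k0] _].
    rewrite /kf mem_nzints_trunc// le_min (shift_le _ _ _ _ _ _ _ _ _ _ _ _ _ sol)//.
    by rewrite (shift_le_crude _ _ _ _ _ _ _ _ _ _ _ _ sol).
  move=> k; rewrite mem_nzints => /andP[k0 _].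
  have kp : 0 < `|k%:~R : F| by rewrite normr_gt0 intr_eq0.
  have -> : 16 * delta * R * H * `|k%:~R|^-1 =
      2 * ((2 * delta * Q * R / (H * `|k%:~R|)) / (Q / (2 * H) ^+ 2)) :> F.
    by field; rewrite (gt_eqF Q0) (gt_eqF kp) (gt_eqF H0).
  pose u (x : int * int * int * int * int * int) : F :=
    let: (r, q1, q2, h1, h2, m) := x in r%:~R / h2%:~R.
  apply: (@at_most_spaced _ _ _ u).
  - by rewrite divr_gt0// exprn_gt0// mulr_gt0.
  - by rewrite divr_ge0 ?mulr_ge0 ?(ltW H0) ?(ltW R0) ?(ltW d0) ?(ltW Q0).
  - move=> [[[[[r q3] q4] h1] h2] m] [[[[[r' q3'] q4'] h1'] h2'] m'].
    move=> [[[[[[_ [/andP[q1l q1u] _] [_ /andP[h2l h2u]] _] E _] prh prq] _] [? ?]] kk].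
    subst q3 q4.
    move=> [[[[[[_ _ [_ /andP[h2l' h2u']] _] E' _] prh' _] _] [? ?]] kk']; subst q3' q4'.
    move=> neq.
    have mm : m' = m by move: kk kk'; rewrite /kf; clear; lia.
    subst m'.
    have q10 := @intr_norm_gt0 _ _ _ Q0 q1l.
    have hp : 0 < h2%:~R :> F by exact: lt_le_trans h2l.
    have hp' : 0 < h2'%:~R :> F by exact: lt_le_trans h2l'.
    apply: slope_spacing; rewrite ?gt_eqF ?mulr_gt0//.
    + by rewrite gtr0_norm// ltW.
    + by rewrite gtr0_norm// ltW.
    rewrite -!intrM -intrB; apply: (le_trans q1l).
    (* Dual to the case of large Q: the linear equations make [q1] divide the determinant times [q2]
       and times m, hence the determinant. *)
    have D1 : (r * h2' - r' * h2) * q2 = q1 * (r * h1' - r' * h1).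
      have -> : (r * h2' - r' * h2) * q2 = r * (h2' * q2) - r' * (h2 * q2) by ring.
      have -> : h2' * q2 = h1' * q1 - r' * m by rewrite -E'; ring.
      have -> : h2 * q2 = h1 * q1 - r * m by rewrite -E; ring.
      by ring.
    have D2 : (r * h2' - r' * h2) * m = q1 * (h1 * h2' - h1' * h2).
      have -> : (r * h2' - r' * h2) * m = (r * m) * h2' - (r' * m) * h2 by ring.
      by rewrite -E -E'; ring.
    apply: (primitive_norm_le _ _ _ _ _ _ _ prq _ D1 D2).
    apply/negP => /eqP D0; apply: neq.
    move: D1 D2; rewrite D0 !mul0r => /esym/eqP.
    rewrite mulf_eq0 (negPf q10)/= subr_eq0 => /eqP D1.
    move=> /esym/eqP; rewrite mulf_eq0 (negPf q10)/= subr_eq0 => /eqP D2.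
    move/eqP: D0; rewrite subr_eq0 => /eqP D0.
    (* The triples are rotated to put [h2] first: it is positive, whereas r has no fixed sign. *)
    have [| | | |-> -> ->//] := primitive_proportional _ _ _ _ _ _
      (primitive_rot _ _ _ prh) (primitive_rot _ _ _ prh').
    + by rewrite mulrC -D0 mulrC.
    + by rewrite mulrC -D2 mulrC.
    + by [].
    + by rewrite mulr_gt0// -(ltr0z F).
  - move=> [[[[[r q3] q4] h1] h2] m] [[[[[r' q3'] q4'] h1'] h2'] m'].
    move=> [[[[[[/andP[_ rR] [_ /andP[q2l q2u]] [_ /andP[h2l h2u]] _] _ T] _ _] _] [? ?]] kk].
    subst q3 q4.
    move=> [[[[[[/andP[_ rR'] _ [_ /andP[h2l' h2u']] _] _ T'] _ _] _] [? ?]] kk']; subst q3' q4'.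
    have mm : m' = m by move: kk kk'; rewrite /kf; clear; lia.
    subst m'; rewrite /kf in kk; rewrite kk in T T'.
    have hp : 0 < h2%:~R :> F by exact: lt_le_trans h2l.
    have hp' : 0 < h2'%:~R :> F by exact: lt_le_trans h2l'.
    have -> : u (r, q1, q2, h1, h2, m) - u (r', q1, q2, h1', h2', m)
        = (r * h2' - r' * h2)%:~R / (h2%:~R * h2'%:~R).
      by rewrite /u; field; rewrite (gt_eqF hp) (gt_eqF hp').
    (* Cross-multiplying the two energies by [r] and [r'] cancels the terms without [h2], leaving
       the determinant times [q2 * k]. *)
    have D : `|(r * h2' - r' * h2)%:~R : F| * (Q * `|k%:~R|)
        <= 2 * (R * (delta * H * Q ^+ 2)).
      apply: (@le_trans _ _ `|((r * h2' - r' * h2) * (q2 * k))%:~R|).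
        by rewrite !intrM !normrM ler_wpM2l// ler_wpM2r.
      have -> : (r * h2' - r' * h2) * (q2 * k)
          = r * (h2' * q2 * k - r' * m * (q1 - m)) - r' * (h2 * q2 * k - r * m * (q1 - m)).
        by ring.
      rewrite intrB (intrM _ r) (intrM _ r'); apply: le_trans (ler_normB _ _) _.
      rewrite [leRHS](mulr_natl _ 2) mulr2n.
      by apply: lerD; apply: normr_bounds_mul => //; exact: ltW.
    have Qk : 0 < Q * `|k%:~R| :> F by rewrite mulr_gt0.
    have HH : 0 < H ^+ 2 by rewrite exprn_gt0.
    have hh : 0 < h2%:~R * h2'%:~R :> F by rewrite mulr_gt0.
    rewrite normrM normfV (gtr0_norm hh) ler_pdivrMr//.
    move: D; rewrite -ler_pdivlMr// => /le_trans; apply.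
    have -> : 2 * (R * (delta * H * Q ^+ 2)) / (Q * `|k%:~R|)
        = 2 * delta * Q * R / (H * `|k%:~R|) * H ^+ 2 :> F.
      by field; rewrite (gt_eqF Q0) (gt_eqF kp) (gt_eqF H0).
    rewrite ler_wpM2l// ?expr2 ?ler_pM ?(ltW H0)//.
    by rewrite divr_ge0 ?mulr_ge0 ?(ltW H0) ?(ltW R0) ?(ltW d0) ?(ltW Q0).
rewrite /X.
have -> : 2 * (2 * Q) * (2 * (2 * Q)) *
  (6 * (R * Q / H + 2 * (delta * Q)) + 16 * delta * R * H * (2 * harm n))
  = 96 * (R * Q * (Q * Q / H)) + 192 * (1 * Q * Q * (delta * Q))
    + 512 * (R * H * Q * (delta * Q) * harm n).
  by field; rewrite (gt_eqF H0).
rewrite lerD2r lerD// ler_wpM2l//.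
  rewrite (mulrAC R) ler_wpM2r ?(ltW Q0)// ler_wpM2l ?(ltW R0)//.
  by rewrite ler_pdivrMr// ler_pM// ltW.
rewrite ler_wpM2r ?mulr_ge0 ?(ltW d0) ?(ltW Q0)// ler_wpM2r ?(ltW Q0)//.
by rewrite ler_pM ?(ltW Q0).
Qed.

Lemma card_primitive (R Q H delta : F) (n : nat) :
  0 < R -> 0 < Q -> 0 < H -> 0 < delta -> R <= H / 2 -> (0 < n)%N ->
  24 * H * Q <= n%:R ->
  at_most (primitive_solution R Q H delta)
    (2048 * (R * H * Q * (1 + delta * Q) * harm n)).
Proof.
move=> R0 Q0 H0 d0 RH n0 Hn.
have RHQ : 0 < R * H * Q by rewrite !mulr_gt0.
have L1 : 1 <= harm n :> F by exact: harm_ge1.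
have dQ : 0 < delta * Q by rewrite mulr_gt0.
have RHQd : 0 < R * H * Q * (delta * Q) by rewrite mulr_gt0.
have RHQL : R * H * Q <= R * H * Q * harm n by rewrite ler_peMr// ltW.
have RHQdL : R * H * Q * (delta * Q) <= R * H * Q * (delta * Q) * harm n.
  by rewrite ler_peMr// ltW.
have -> : 2048 * (R * H * Q * (1 + delta * Q) * harm n) =
  2048 * (R * H * Q * harm n) + 2048 * (R * H * Q * (delta * Q) * harm n) by ring.
have [HQ|/ltW QH] := leP H Q.
  apply: at_most_trans (card_primitive_largeQ _ _ _ _ R0 Q0 H0 d0 RH HQ) _.
  by clear -RHQL RHQdL; lra.
(* The rescaled R may be below 1; then no nonzero integer r satisfies |r| < R. *)
have [R1|/ltW R1] := leP 1 R; last first.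
  apply: at_most_empty; first by clear -RHQ RHQd RHQL RHQdL; lra.
  move=> [[[[[r q1] q2] h1] h2] m] [[[/andP[r0 rR] _ _ _] _ _] _ _].
  have := lt_le_trans rR R1; rewrite ltNge => /negP; apply.
  by move: r0; rewrite -intr_norm ltr0z -[1]/(1%:~R) ler_int.
apply: at_most_trans (at_most_disj _ _ _ _ _ _ _
  (card_primitive_shift0 _ _ _ delta R0 Q0 H0 QH)
  (card_primitive_shiftN0 _ _ _ _ _ R1 Q0 H0 d0 RH QH Hn)) _.
  move=> [[[[[r q1] q2] h1] h2] m] sol.
  by have [k0|k0] := eqVneq (2 * m - q1 + q2) 0; [left|right].
by clear -RHQ RHQd RHQL RHQdL; lra.
Qed.

End PrimitiveSmall.

(** * Reduction to primitive triples *)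

Definition gcd3 (a b c : int) : nat := gcdn `|a| (gcdn `|b| `|c|).

Lemma gcd3_dvd (a b c : int) : [/\ (Posz (gcd3 a b c) %| a)%Z,
  (Posz (gcd3 a b c) %| b)%Z & (Posz (gcd3 a b c) %| c)%Z].
Proof.
rewrite /gcd3 !dvdzE /=; split; first exact: dvdn_gcdl.
  by apply: dvdn_trans (dvdn_gcdr _ _) _; exact: dvdn_gcdl.
by apply: dvdn_trans (dvdn_gcdr _ _) _; exact: dvdn_gcdr.
Qed.

Lemma primitive_gcd3 (a b c d : int) : d = gcd3 a b c -> d != 0 ->
  primitive (a %/ d)%Z (b %/ d)%Z (c %/ d)%Z.
Proof.
move=> dE d0; have [] := gcd3_dvd a b c; rewrite -dE.
move=> /divzK da /divzK db /divzK dc.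
have [u [v uv]] := Bezoutz b c; have [u' [v' uv']] := Bezoutz a (gcdz b c).
exists u', (v' * u), (v' * v); apply: (mulIf d0).
rewrite !mulrDl mul1r -!mulrA da db dc -addrA -mulrDr uv uv' dE /gcd3 /gcdz.
by [].
Qed.

Section Final.
Context {F : realType}.

(** The linear equation scales by i j. The energy and [H * Q ^+ 2] both scale by i j^2, so [delta]
    is unchanged. *)
Lemma shifted_solution_scale (R Q H delta : F) (i j r q1 q2 h1 h2 m : int) :
  0 < i -> 0 < j ->
  shifted_solution R Q H delta (r * i, q1 * j, q2 * j, h1 * i, h2 * i, m * j) ->
  shifted_solution (R / i%:~R) (Q / j%:~R) (H / i%:~R) delta
    (r, q1, q2, h1, h2, m).
Proof.
move=> i0 j0 [[/andP[r0 rR] [/andP[a b] /andP[c d]] [/andP[e f] /andP[g h]] pos] E T].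
have iF : 0 < i%:~R :> F by rewrite ltr0z.
have jF : 0 < j%:~R :> F by rewrite ltr0z.
move: r0 rR a b c d e f g h; rewrite !intrM !normrM !(gtr0_norm iF) !(gtr0_norm jF).
move=> r0 rR a b c d e f g h.
split; first split.
- by rewrite ltr_pdivlMr// rR andbT -(pmulr_lgt0 _ iF).
- by rewrite !mulrA !ler_pdivrMr// !ltr_pdivlMr// a b c d.
- by rewrite !mulrA !ler_pdivrMr// !ltr_pdivlMr// e f g h.
- have : 0 < q1 * q2 * (j * j) by move: pos; rewrite mulrACA.
  by rewrite pmulr_lgt0// mulr_gt0.
- have ij : i * j != 0 by rewrite mulf_neq0 ?gt_eqF.
  apply: (mulIf ij); rewrite mulrBl -!(mulrACA _ i) E; ring.
have ij : 0 < i%:~R * j%:~R ^+ 2 :> F by rewrite mulr_gt0// exprn_gt0.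
rewrite -(ler_pM2r ij) -[X in _ * X <= _](gtr0_norm ij) -normrM.
apply: le_trans; last apply: le_trans T _.
- rewrite le_eqVlt; apply/orP; left; apply/eqP; congr (`|_|); ring.
- rewrite le_eqVlt; apply/orP; left; apply/eqP; field.
  by rewrite (gt_eqF iF) (gt_eqF jF).
Qed.

Lemma harm_iota (n : nat) : \sum_(k <- iota 1 n) k%:R^-1 = harm n :> F.
Proof. by rewrite /harm /index_iota subSS subn0. Qed.

(** Two of the factors [harm n] come from summing 1 / i and 1 / j over the gcds, the third from the
    primitive count. *)
Lemma card_shifted (R Q H delta : F) (n : nat) :
  0 < R -> 1 <= Q -> 1 <= H -> 0 < delta -> R <= H / 2 -> 24 * H * Q <= n%:R ->
  at_most (shifted_solution R Q H delta)
    (2048 * (R * H * Q * (1 + delta * Q)) * harm n ^+ 3).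
Proof.
move=> R0 Q1 H1 d0 RH Hn.
have Q0 : 0 < Q by lra.
have H0 : 0 < H by lra.
have HQ : 1 * 1 <= H * Q by rewrite ler_pM.
have n0 : (0 < n)%N by rewrite -(ltr0n F); lra.
have L1 : 1 <= harm n :> F by exact: harm_ge1.
have L0 : 0 <= harm n :> F by lra.
set C := 2048 * _.
pose fi (x : int * int * int * int * int * int) :=
  let: (r, q1, q2, h1, h2, m) := x in gcd3 r h1 h2.
pose fj (x : int * int * int * int * int * int) :=
  let: (r, q1, q2, h1, h2, m) := x in gcd3 q1 q2 m.
(* Each gcd divides a nonzero entry of size at most 2 H or 2 Q, hence lies between 1 and n. *)
have gcdb (a b c d : int) (Y : F) : (a = b \/ a = c) -> a != 0 ->
    `|a%:~R : F| <= Y -> Y <= n%:R -> gcd3 b c d \in iota 1 n.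
  move=> abc a0 aY Yn.
  have gn : (gcd3 b c d <= `|a|)%N.
    apply: dvdn_leq; first by rewrite absz_gt0.
    by have [gb gc _] := gcd3_dvd b c d; case: abc => ->.
  have an : (`|a| <= n)%N by rewrite -(ler_nat F) absz_intr (le_trans aY).
  rewrite mem_iota add1n ltnS (leq_trans gn an) andbT.
  rewrite lt0n; apply/eqP => g0; have [] := gcd3_dvd b c d; rewrite g0.
  rewrite !dvd0z => /eqP b0 /eqP c0 _.
  by move: a0; case: abc => ->; rewrite ?b0 ?c0 eqxx.
apply: (@at_most_trans _ _ _ (\sum_(i <- iota 1 n) C * harm n ^+ 2 * i%:R^-1)); last first.
  by rewrite -mulr_sumr harm_iota -mulrA -exprSr.
apply: (@at_most_fibers _ _ _ fi).
  move=> [[[[[r q1] q2] h1] h2] m] [[_ _ [/andP[hl hu] _] _] _ _].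
  have h0 : 0 < h1%:~R :> F by rewrite (lt_le_trans H0).
  apply: (@gcdb h1 _ _ _ (2 * H)); [by right|by rewrite -(intr_eq0 F) gt_eqF| |].
    by rewrite gtr0_norm// ltW.
  by have := ler_peMr (ltW H0) Q1; lra.
move=> i; rewrite mem_iota => /andP[i0 _].
apply: (@at_most_trans _ _ _ (\sum_(j <- iota 1 n) C * harm n * i%:R^-1 * j%:R^-1)); last first.
  rewrite -mulr_sumr harm_iota.
  by have -> : C * harm n / i%:R * harm n = C * harm n ^+ 2 / i%:R by ring.
apply: (@at_most_fibers _ _ _ fj).
  move=> [[[[[r q1] q2] h1] h2] m] [[[_ [/andP[ql qu] _] _ _] _ _] _].
  apply: (@gcdb q1 _ _ _ (2 * Q)); [by left|exact: intr_norm_gt0 ql|exact: ltW|].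
  by have := ler_peMl (ltW Q0) H1; lra.
move=> j; rewrite mem_iota => /andP[j0 _].
have iF : 1 <= i%:R :> F by rewrite ler1n.
have jF : 1 <= j%:R :> F by rewrite ler1n.
have iF0 : 0 < i%:R :> F by lra.
have jF0 : 0 < j%:R :> F by lra.
pose g (x : int * int * int * int * int * int) :=
  let: (r, q1, q2, h1, h2, m) := x in
  ((r %/ i)%Z, (q1 %/ j)%Z, (q2 %/ j)%Z, (h1 %/ i)%Z, (h2 %/ i)%Z, (m %/ j)%Z).
pose g' (x : int * int * int * int * int * int) :=
  let: (r, q1, q2, h1, h2, m) := x in
  (r * i, q1 * j, q2 * j, h1 * i, h2 * i, m * j).
have gK x : fi x = i -> fj x = j -> g' (g x) = x.
  case: x => [[[[[r q1] q2] h1] h2] m] /= fiE fjE.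
  have [] := gcd3_dvd r h1 h2; rewrite fiE => a b c.
  have [] := gcd3_dvd q1 q2 m; rewrite fjE => d e f.
  by rewrite !divzK.
apply: (@at_most_inj _ _ _ g _ (primitive_solution (R / i%:R) (Q / j%:R) (H / i%:R) delta)).
- move=> x [[sol fiE] fjE]; move: (gK x fiE fjE) sol => {1}<-.
  case: x fiE fjE => [[[[[r q1] q2] h1] h2] m] /= fiE fjE sol; split.
  + exact: (shifted_solution_scale _ _ _ _ i j).
  + by apply: (primitive_gcd3 _ _ _ (Posz i)); rewrite ?fiE// eqz_nat -lt0n.
  + by apply: (primitive_gcd3 _ _ _ (Posz j)); rewrite ?fjE// eqz_nat -lt0n.
- by move=> x y [[_ xi] xj] [[_ yi] yj] gxy; rewrite -(gK x)// gxy gK.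
apply: at_most_trans (card_primitive _ _ _ _ n _ _ _ d0 _ n0 _) _.
- by rewrite divr_gt0.
- by rewrite divr_gt0.
- by rewrite divr_gt0.
- by rewrite mulrAC ler_pM2r// invr_gt0.
- apply: le_trans Hn; rewrite -!(mulrA 24) ler_wpM2l// ler_pM ?divr_ge0 ?(ltW H0) ?(ltW Q0)//;
  by rewrite ler_pdivrMr// ler_peMr// ltW.
(* From the rescaled bound, 1 / i is kept from R and 1 / j from Q; the other rescaled quantities are
   bounded by the original ones. *)
have -> : C * harm n / i%:R / j%:R
    = 2048 * (R / i%:R * H * (Q / j%:R) * (1 + delta * Q) * harm n).
  by rewrite /C; field; rewrite (gt_eqF iF0) (gt_eqF jF0).
have Ri : 0 <= R / i%:R by rewrite divr_ge0 ?(ltW R0).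
have Hi : 0 <= H / i%:R by rewrite divr_ge0 ?(ltW H0).
have Qj : 0 <= Q / j%:R by rewrite divr_ge0 ?(ltW Q0).
have HiH : H / i%:R <= H by rewrite ler_pdivrMr// ler_peMr// ltW.
have QjQ : Q / j%:R <= Q by rewrite ler_pdivrMr// ler_peMr// ltW.
have dQj : 0 <= delta * (Q / j%:R) by rewrite mulr_ge0 ?(ltW d0).
apply: ler_wpM2l; first exact: ler0n.
apply: ler_wpM2r => //; apply: ler_pM.
- by rewrite mulr_ge0// mulr_ge0.
- by rewrite addr_ge0.
- by rewrite ler_wpM2r// ler_wpM2l.
by rewrite lerD2l ler_pM2l.
Qed.
End Final.

(** * Summation over n1 and absorption of the logarithms *)

Theorem theorem2 (F : realType) (eps : F) (heps : 0 < eps) :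
  exists K : F, forall R H Q N delta : F,
    1 <= R -> 1 <= H -> 1 <= Q -> 1 <= N -> R <= H / 2 -> 0 < delta ->
    (nb_solutions R Q H N delta)%:R
      <= K * (R * N * H * Q) `^ (1 + eps) * (1 + delta * Q).
Proof.
(* Each of the three factors [harm n] may cost X ^ (eps / 3). *)
pose eta := eps / 3.
have eta0 : 0 < eta by rewrite divr_gt0.
have ieta0 : 0 < eta^-1 by rewrite invr_gt0.
exists (4096 * (26 + eta^-1) ^+ 3) => R H Q N delta R1 H1 Q1 N1 RH d0.
have R0 : 0 < R by lra.
have H0 : 0 < H by lra.
have Q0 : 0 < Q by lra.
have N0 : 0 < N by lra.
have HQ1 : 1 <= H * Q by rewrite -[1]mulr1 ler_pM.
have HQ0 : 0 <= H * Q by lra.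
have RN1 : 1 <= R * N by rewrite -[1]mulr1 ler_pM.
set X := R * N * H * Q.
have HQX : H * Q <= X by rewrite /X -mulrA ler_peMl.
have X1 : 1 <= X by lra.
have X0 : 0 < X by lra.
pose n := (Num.truncn (24 * H * Q)).+1.
have HQ24 : 0 <= 24 * H * Q by lra.
have nl : 24 * H * Q <= n%:R by apply/ltW/truncnS_gt.
have nu : n%:R <= 25 * X.
  have : (Num.truncn (24 * H * Q))%:R <= 24 * H * Q by rewrite truncn_le.
  by rewrite /n -natr1; lra.
have Xe1 : 1 <= X `^ eta by rewrite -(powRr0 X) ler_powR// ltW.
(* From [n <= 25 * X]: 1 + ln n <= 1 + 25 + X ^ eta / eta, and X ^ eta >= 1 absorbs the constant
   26. *)
have L : harm n <= (26 + eta^-1) * X `^ eta.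
  apply: le_trans (harm_le_ln _) _.
  have n0 : 0 < n%:R :> F by rewrite ltr0n.
  have : ln (n%:R : F) <= ln 25 + ln X.
    by rewrite -lnM ?posrE// ler_ln ?posrE// mulr_gt0.
  have : ln (25 : F) < 25 by apply: ln_sublinear.
  have := ln_le_powR _ _ eta0 X0.
  set l1 := ln _; set l2 := ln _; set l3 := ln _; set Y := X `^ eta in Xe1 *.
  by move=> a b c; rewrite mulrDl (mulrC eta^-1); clear -a b c Xe1; lra.
have L0 : 0 <= harm n :> F by rewrite sumr_ge0.
have count : (nb_solutions R Q H N delta)%:R <=
    2 * N * (2048 * (R * H * Q * (1 + delta * Q)) * harm n ^+ 3).
  rewrite /nb_solutions.
  have dQ : 0 <= delta * Q by rewrite mulr_ge0 ?(ltW d0) ?(ltW Q0).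
  pose f (x : int * int * int * int * int * int * int) :=
    let: (r, q1, q2, h1, h2, n1, n2) := x in n1.
  have B : at_most (solutions R Q H N delta)
      (2 * N * (2048 * (R * H * Q * (1 + delta * Q)) * harm n ^+ 3)).
    apply: (@at_most_const_fibers _ _ _ f (nzints (Num.truncn N))).
    - move=> [[[[[[r q1] q2] h1] h2] n1] n2] [[_ _ _ [/andP[n1l n1u] _] _] _ _].
      rewrite /f mem_nzints_trunc//; last by rewrite ger0_norm//; lra.
      by rewrite -(intr_eq0 F) gt_eqF//; lra.
    - by rewrite size_nzints// ltW.
    - have RHQ : 0 <= R * H * Q * (1 + delta * Q).
        rewrite mulr_ge0 ?addr_ge0// mulr_ge0 ?(ltW Q0)// mulr_ge0 ?(ltW R0)//.
        exact: ltW.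
      apply: mulr_ge0; last exact: exprn_ge0.
      by apply: mulr_ge0 RHQ; exact: ler0n.
    move=> n1 _.
    pose g (x : int * int * int * int * int * int * int) :=
      let: (r, q1, q2, h1, h2, n1, n2) := x in (r, q1, q2, h1, h2, n2 - n1).
    apply: (@at_most_inj _ _ _ g _ (shifted_solution R Q H delta)); last first.
      exact: card_shifted.
    - move=> [[[[[[r q1] q2] h1] h2] a1] a2] [[[[[[r' q1'] q2'] h1'] h2'] a1'] a2'].
      by move=> [_ /= ->] [_ /= ->] [-> -> -> -> -> /addIr ->].
    move=> [[[[[[r q1] q2] h1] h2] a1] a2] [[[r0 q h _ pos] E T] _]; split => //.
      by apply/eqP; rewrite -subr_eq0 -(subrr (r * a1 + h1 * q1)) {2}E; apply/eqP; ring.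
    move: T; rewrite -normrN -intrN.
    have hq : h1 * q1 = h2 * q2 + r * (a2 - a1).
      by apply/eqP; rewrite -subr_eq0 -(subrr (r * a1 + h1 * q1)) {2}E; apply/eqP; ring.
    (* Isolating [h1 * q1] lets the linear equation eliminate [h1]; what remains is the negative of
       the energy in [shifted_solution]. *)
    have -> : r * a1 ^+ 2 + 2 * h1 * q1 * a1 + h1 * q1 ^+ 2
      = r * a1 ^+ 2 + 2 * (h1 * q1) * a1 + h1 * q1 * q1 by ring.
    rewrite hq; congr (is_true (`|_%:~R| <= _)); ring.
  apply: B; first exact: finmap.fset_uniq.
  by move=> x; rewrite in_fset_set; [exact: set_mem|exact: finite_solutions].
apply: le_trans count _.
have X3 : X `^ (1 + eps) = X * (X `^ eta) ^+ 3.
  rewrite powRD; last by rewrite (gt_eqF X0) implybT.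
  rewrite powRr1 ?(ltW X0)//; congr (_ * _).
  by rewrite -powR_mulrn ?powR_ge0// -powRrM; congr (_ `^ _); rewrite /eta; field.
rewrite X3.
have L3 : harm n ^+ 3 <= (26 + eta^-1) ^+ 3 * (X `^ eta) ^+ 3.
  by rewrite -exprMn lerXn2r ?nnegrE// (le_trans L0).
have dQ : 0 < 1 + delta * Q by rewrite addr_gt0// mulr_gt0.
have Z : 0 <= 4096 * X * (1 + delta * Q).
  by do 2?apply: mulr_ge0; [exact: ler0n|exact: ltW|exact: ltW].
have := ler_wpM2l Z L3.
have -> : 2 * N * (2048 * (R * H * Q * (1 + delta * Q)) * harm n ^+ 3) =
  4096 * X * (1 + delta * Q) * harm n ^+ 3 by rewrite /X; ring.
move=> /le_trans; apply; rewrite le_eqVlt; apply/orP; left; apply/eqP; ring.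
Qed.
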